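(* Let $K\subset S^3$ be a knot. (1) $\Upsilon_K$ is a continuous piecewise linear function (on $[0,2]$). (2) At a nonsingular point $t$ of $\Upsilon_K'$, the value of $|\Upsilon_K'(t)|$ is $|i-j|$, where $(i,j)$ is the bifiltration level of some filtered generator of $\mathrm{CF}(K)$ of homological grading $0$. (3) Singularities of $\Upsilon_K'(t)$ can occur only at values of $t$ such that some line of slope $1-\frac2t$ in the plane contains at least two distinct lattice points $(i,j)$ and $(i',j')$, each of which is the pair of algebraic and Alexander filtration levels of a filtered generator of $\mathrm{CF}(K)$ of homological grading $0$. (4) If $\Upsilon_K'$ has a singularity at $t$, then the jump $\Delta\Upsilon_K'(t)$ of $\Upsilon_K'$ at $t$ satisfies $|\Delta\Upsilon_K'(t)|=\frac2t|i-i'|$ for some pair $(i,i')$ for which there are lattice points $(i,j)$ and $(i',j')$ as in (3).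
   Context: $\mathbb F$ is the field with two elements and $\Lambda=\mathbb F[U,U^{-1}]$. For a knot $K\subset S^3$, $\mathrm{CF}(K)$ denotes the Heegaard Floer knot complex $\mathrm{CFK}^\infty(K)$ over $\mathbb F$. It is a chain complex with an integer (Maslov, or homological) grading $gr$ and boundary map $\partial$ of degree $-1$, and two increasing integer-valued filtrations by subcomplexes, the Alexander and the algebraic filtration; $Alex(x)$ and $Alg(x)$ denote the corresponding filtration levels of $x$. $\mathrm{CF}(K)$ is a $\Lambda$-module; $U$ commutes with $\partial$, lowers the grading by $2$ and lowers both filtration levels by $1$. As a $\Lambda$-module it is free on a finite set $\{x_i\}$ such that $\{U^kx_i\}_{k\in\mathbb Z}$ is a bifiltered graded basis over $\mathbb F$: for all integers $g,m,n$ the subspace spanned by elements of grading $g$, Alexander level $\le m$ and algebraic level $\le n$ has a subset of $\{U^kx_i\}$ as basis. Fix such a basis; its elements $U^kx_i$ are the filtered generators of $\mathrm{CF}(K)$, and the bifiltration level of a filtered generator $x$ is $(i,j)=(Alg(x),Alex(x))$, viewed as a lattice point in the plane. The singly filtered complex $(\mathrm{CF}(K),Alg)$ with its $\Lambda$-structure is chain homotopy equivalent to $\Lambda$ with zero differential, with $1\in\Lambda$ in grading $0$ and filtration level $0$. For $t\in[0,2]$, the filtration $\mathcal F_t$ on $\mathrm{CF}(K)$ is defined by letting $(\mathrm{CF}(K),\mathcal F_t)_s$, $s\in\mathbb R$, be the span of all $x$ with $\frac t2 Alex(x)+(1-\frac t2)Alg(x)\le s$; these are subcomplexes. Define $\nu(\mathrm{CF}(K),\mathcal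 F_t)=\min\{s : H_0((\mathrm{CF}(K),\mathcal F_t)_s)\to H_0(\mathrm{CF}(K))\text{ is surjective}\}$ and $\Upsilon_K(t)=-2\,\nu(\mathrm{CF}(K),\mathcal F_t)$. $\Upsilon_K'$ is the derivative of $\Upsilon_K$; a singularity of $\Upsilon_K'$ is a point $t\in(0,2)$ at which $\Upsilon_K$ is not differentiable, other points of $(0,2)$ are nonsingular, and $\Delta\Upsilon_K'(t)$ is the right-hand derivative minus the left-hand derivative of $\Upsilon_K$ at $t$. *)

(* Defs.v *)
From HB Require Import structures.
From mathcomp Require Import all_boot all_order all_algebra.
From mathcomp Require Import all_classical all_reals all_analysis.

Set Implicit Arguments.
Unset Strict Implicit.
Unset Printing Implicit Defensive.

Import Order.TTheory GRing.Theory Num.Theory.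
Import numFieldNormedType.Exports.

Local Open Scope classical_set_scope.
Local Open Scope ring_scope.

(* F[U, U^-1], as the subring of the field of fractions F(U) of F[U] made of
   the fractions p / U^n. *)
Definition fracU : {fraction {poly 'F_2}} := FracField.tofrac 'X.

Definition laurent_pred : {pred {fraction {poly 'F_2}}} :=
  fun x => `[< exists (p : {poly 'F_2}) (n : nat),
                 x = FracField.tofrac p / fracU ^+ n >].

Lemma fracU_neq0 : fracU != 0.
Proof. by rewrite tofrac_eq0 polyX_eq0. Qed.

Lemma laurent_subring : subring_closed laurent_pred.
Proof.
split=> [|x y /asboolP[p [m ->]] /asboolP[q [n ->]]
          |x y /asboolP[p [m ->]] /asboolP[q [n ->]]].
- by apply/asboolP; exists 1, 0%N; rewrite expr0 divr1 tofrac1.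
- apply/asboolP; exists (p * 'X ^+ n - q * 'X ^+ m), (m + n)%N.
  rewrite tofracB !tofracM !tofracXn -/fracU exprD -mulNr.
  rewrite addf_div ?expf_neq0 ?fracU_neq0 //.
  by rewrite mulNr.
- apply/asboolP; exists (p * q), (m + n)%N.
  by rewrite tofracM exprD mulf_div.
Qed.

HB.instance Definition _ :=
  GRing.isSubringClosed.Build _ laurent_pred laurent_subring.

Record Laurent := MkLaurent {
  laurent_val : {fraction {poly 'F_2}};
  laurent_valP : laurent_val \in laurent_pred
}.

HB.instance Definition _ := [isSub for laurent_val].
HB.instance Definition _ := [Choice of Laurent by <:].
HB.instance Definition _ := [SubChoice_isSubComNzRing of Laurent by <:].

Lemma laurent_exprz (k : int) : fracU ^ k \in laurent_pred.
Proof.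
apply/asboolP; case: k => n.
- by exists ('X ^+ n), 0%N; rewrite expr0 divr1 tofracXn.
- by exists 1, n.+1; rewrite tofrac1 div1r NegzE exprnN.
Qed.

Definition Upow (k : int) : Laurent := MkLaurent (laurent_exprz k).

(* Since F has two elements, the F-linear subspaces of a Laurent-module are
   its additive subgroups, and an F-linear combination of a finite set of
   vectors is the sum of a subset. *)
Definition is_subspace (V : lmodType Laurent) (S : set V) : Prop :=
  S 0 /\ (forall x y, S x -> S y -> S (x - y)).

Definition Fspan (V : lmodType Laurent) (S : set V) : set V :=
  smallest (@is_subspace V) S.

Definition Ffree (V : lmodType Laurent) (B : set V) : Prop :=
  forall s : seq V, uniq s -> (forall x, x \in s -> B x) ->
    \sum_(x <- s) x = 0 -> s = [::].

Definition is_Fbasis (V : lmodType Laurent) (B S : set V) : Prop :=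
  Ffree B /\ Fspan B = S.

Record gcomplex := GComplex {
  gcar :> lmodType Laurent;
  gr : int -> set gcar;
  bd : {linear gcar -> gcar}
}.

Definition graded_subspace (C : gcomplex) (S : set C) : Prop :=
  is_subspace S /\ S `<=` Fspan (S `&` \bigcup_g gr g).

Record is_gcomplex (C : gcomplex) : Prop := {
  gr_subspace : forall g, is_subspace (@gr C g);
  gr_span : graded_subspace [set: C];
  gr_direct : forall (s : seq int) (y : int -> C), uniq s ->
    (forall g, gr g (y g)) -> \sum_(g <- s) y g = 0 ->
    forall g, g \in s -> y g = 0;
  gr_U : forall g (x : C), gr g x -> gr (g - 2) (Upow 1 *: x);
  gr_bd : forall g (x : C), gr g x -> gr (g - 1) (bd C x);
  bd_bd : forall x : C, bd C (bd C x) = 0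
}.

Definition has_level (V : lmodType Laurent) (Fil : int -> set V) (x : V)
    (m : int) : Prop :=
  Fil m x /\ ~ Fil (m - 1) x.

(* An increasing integer-valued filtration by (graded) subcomplexes; every
   nonzero element has a level, i.e. the filtration is exhaustive and
   separated. *)
Record is_filtration (C : gcomplex) (Fil : int -> set C) : Prop := {
  fil_graded : forall m, graded_subspace (Fil m);
  fil_incr : forall m n, m <= n -> Fil m `<=` Fil n;
  fil_bd : forall m x, Fil m x -> Fil m (bd C x);
  fil_level : forall x, x <> 0 -> exists m, has_level Fil x m;
  fil_U : forall m x, Fil m x <-> Fil (m - 1) (Upow 1 *: x)
}.

Definition graded_map (C D : gcomplex) (d : int) (f : C -> D) : Prop :=
  forall g x, gr g x -> gr (g + d) (f x).

Definition filtered_map (C D : gcomplex) (FC : int -> set C)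
    (FD : int -> set D) (f : C -> D) : Prop :=
  forall m x, FC m x -> FD m (f x).

(* Laurent-linear chain homotopy equivalence of graded, singly filtered
   complexes. *)
Definition filtered_homotopy_equivalent (C D : gcomplex)
    (FC : int -> set C) (FD : int -> set D) : Prop :=
  exists (f : {linear C -> D}) (g : {linear D -> C})
         (hC : {linear C -> C}) (hD : {linear D -> D}),
  [/\ [/\ graded_map 0 f, filtered_map FC FD f &
          forall x, f (bd C x) = bd D (f x)],
      [/\ graded_map 0 g, filtered_map FD FC g &
          forall y, g (bd D y) = bd C (g y)],
      [/\ graded_map 1 hC, filtered_map FC FC hC &
          forall x, g (f x) - x = bd C (hC x) + hC (bd C x)] &
      [/\ graded_map 1 hD, filtered_map FD FD hD &
          forall y, f (g y) - y = bd D (hD y) + hD (bd D y)]].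

Definition Laurent_gr (g : int) : set Laurent^o :=
  Fspan [set (Upow k : Laurent^o) | k in [set k : int | - (2 * k) = g]].

Definition Laurent_fil (m : int) : set Laurent^o :=
  Fspan [set (Upow k : Laurent^o) | k in [set k : int | - k <= m]].

Definition Laurent_complex : gcomplex :=
  @GComplex Laurent^o Laurent_gr (\0 : {linear Laurent^o -> Laurent^o}).

(* The algebraic structure carried by CFK^oo of a knot in the three-sphere,
   together with a choice of bifiltered graded basis. *)
Record knot_complex := KnotComplex {
  CF :> gcomplex;
  Alex : int -> set CF;
  Alg : int -> set CF;
  ngen : nat;
  xgen : 'I_ngen -> CF;
  CF_complex : is_gcomplex CF;
  Alex_filtration : is_filtration Alex;
  Alg_filtration : is_filtration Alg;
  CF_free : forall v : CF, exists! l : {ffun 'I_ngen -> Laurent},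
    v = \sum_a l a *: xgen a;
  CF_basis : forall g m n : int,
    exists2 B : set CF,
      B `<=` [set Upow ka.1 *: xgen ka.2 | ka in [set: int * 'I_ngen]] &
      is_Fbasis B (gr g `&` Alex m `&` Alg n);
  CF_Laurent :
    @filtered_homotopy_equivalent CF Laurent_complex Alg Laurent_fil
}.

Definition filtered_generator (K : knot_complex) : set K :=
  [set Upow ka.1 *: xgen ka.2 | ka in [set: int * 'I_(ngen K)]].

(* p is the pair (algebraic level, Alexander level) of a filtered generator of
   grading 0. *)
Definition gr0_level (K : knot_complex) (p : int * int) : Prop :=
  exists x : K, [/\ filtered_generator x, gr 0 x,
    has_level (@Alg K) x p.1 & has_level (@Alex K) x p.2].

Section Upsilon.
Variables (R : realType) (K : knot_complex).

Definition filt (t s : R) : set K :=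
  Fspan [set x : K | exists m n : int,
    [/\ has_level (@Alex K) x m, has_level (@Alg K) x n &
        t / 2 * m%:~R + (1 - t / 2) * n%:~R <= s]].

(* Surjectivity of H_0((CF, F_t)_s) -> H_0(CF), on representatives. *)
Definition H0_surjective (t s : R) : Prop :=
  forall z : K, gr 0 z -> bd K z = 0 ->
    exists z' w : K, [/\ gr 0 z', bd K z' = 0, filt t s z', gr 1 w &
      z = z' + bd K w].

Definition nu (t : R) : R :=
  get [set s : R | H0_surjective t s /\
                   forall s', H0_surjective t s' -> s <= s'].

Definition Upsilon (t : R) : R := - 2 * nu t.

End Upsilon.

Definition piecewise_linear (R : realType) (a b : R) (f : R -> R) : Prop :=
  exists2 s : seq R, itv_partition a b s &
    forall k, (k < size s)%N -> exists c d : R,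
      {in `[nth b (a :: s) k, nth b (a :: s) k.+1], forall x, f x = c * x + d}.

Definition singular (R : realType) (f : R -> R) (t : R) : Prop :=
  ~ derivable f t 1.

Definition right_derivative (R : realType) (f : R -> R) (t d : R) : Prop :=
  (h^-1 * (f (t + h) - f t)) @[h --> 0^'+] --> d.

Definition left_derivative (R : realType) (f : R -> R) (t d : R) : Prop :=
  (h^-1 * (f (t + h) - f t)) @[h --> 0^'-] --> d.

Definition derivative_jump (R : realType) (f : R -> R) (t delta : R) : Prop :=
  exists dr dl : R, [/\ right_derivative f t dr, left_derivative f t dl &
    delta = dr - dl].

Definition on_line (R : realType) (slope c : R) (p : int * int) : Prop :=
  p.2%:~R = slope * p.1%:~R + c.

Definition collinear_gr0_pair (R : realType) (K : knot_complex) (t : R)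
    (p q : int * int) : Prop :=
  [/\ p <> q, gr0_level K p, gr0_level K q &
      exists c : R, on_line (1 - 2 / t) c p /\ on_line (1 - 2 / t) c q].

(* Main.v *)
(* In grading 0 the subcomplex (CF(K), F_t)_s is spanned by the finitely many
   filtered generators x of grading 0 with
   l_x(t) = t/2 Alex(x) + (1 - t/2) Alg(x) <= s.  Hence nu(t) is the least s for
   which the set {x | l_x(t) <= s} has a fixed property (its span meets every
   class of H_0), stable under enlarging the set, true for all generators and
   false for none because H_0 <> 0.  So nu(t) is always one of the values l_x(t),
   it is Lipschitz, and it follows a single line l_x as long as the order of the
   values l_y(t) does not change, that is between consecutive crossings of the
   lines.  To the right and to the left of t the function Upsilon = -2 nu thus
   follows lines of slopes i - j and i' - j' that agree at t; this is
   collinearity of (i, j) and (i', j') along slope 1 - 2/t, and it gives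
   (i - j) - (i' - j') = 2/t (i - i'). *)

Require Import Defs.
From mathcomp Require Import all_boot all_order all_algebra.
From mathcomp Require Import all_classical all_reals all_analysis.
From mathcomp Require Import ring lra zify.

Set Implicit Arguments.
Unset Strict Implicit.
Unset Printing Implicit Defensive.

Import Order.TTheory GRing.Theory Num.Theory.
Import numFieldNormedType.Exports.

Local Open Scope classical_set_scope.
Local Open Scope ring_scope.

(** * Least sublevel values of finitely many affine functions *)

Lemma seq_argmin (R : realDomainType) (T : eqType) (h : T -> R) (s : seq T) :
  s != [::] -> exists2 x, x \in s & forall y, y \in s -> h x <= h y.
Proof.
elim: s => // a [|b s] IH _.
  by exists a => [|y]; rewrite ?mem_seq1 // => /eqP ->.
have [//|x xs hx] := IH.
have [ax|xa] := leP (h a) (h x).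
  exists a; first exact: mem_head.
  by move=> y; rewrite inE => /orP[/eqP -> //|/hx]; apply: le_trans.
exists x; first by rewrite inE xs orbT.
by move=> y; rewrite inE => /orP[/eqP ->|/hx //]; exact: ltW.
Qed.

Section MinimalLevel.
Variables (R : realType) (T : eqType) (A : seq T) (c d : T -> R).
(** Stands for [H0_surjective_span]. Keeping it abstract separates the study of affine functions
    from the algebra of the knot complex. *)
Variable F : set T -> Prop.
Hypothesis F_incr : forall X Y : set T,
  (forall x, x \in A -> X x -> Y x) -> F X -> F Y.
Hypothesis F_full : F setT.
Hypothesis F_empty : ~ F set0.

Let line x t := c x * t + d x.
Let sub t s : set T := [set x | line x t <= s].

Definition min_level (t s : R) : Prop :=
  F (sub t s) /\ forall s', F (sub t s') -> s <= s'.

Lemma min_level_line t : exists2 x, x \in A & min_level t (line x t).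
Proof.
pose B := [seq x <- A | `[< F (sub t (line x t)) >]].
(* Lowering [s'] to the largest line value not above it keeps the same elements of [A] in the
   sublevel set. Such a value exists, since otherwise [F] would hold of the empty set. *)
have maxB s' : F (sub t s') -> exists2 y, y \in B & line y t <= s'.
  move=> Fs'; pose L := [seq x <- A | line x t <= s'].
  have L0 : L != [::].
    apply: contra_notN F_empty => /eqP L0.
    apply: F_incr Fs' => x xA /= xs.
    have : x \in L by rewrite mem_filter [line x t <= s']xs.
    by rewrite L0.
  have [y + ymax] := seq_argmin (fun x => - line x t) L0.
  rewrite mem_filter => /andP[ys yA].
  exists y => //; rewrite mem_filter yA andbT; apply/asboolP.
  apply: F_incr Fs' => x xA /= xs; rewrite /sub /= -lerN2 ymax //.
  by rewrite mem_filter [line x t <= s']xs.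
have B0 : B != [::].
  (* [M] bounds every line value at [t], so its sublevel set contains all of [A] and [F_full]
     applies. *)
  pose M := \sum_(x <- A) `|line x t|.
  apply/eqP => B0; have [|y] := @maxB M; last by rewrite B0.
  apply: F_incr F_full => x xA _ /=; apply: (le_trans (ler_norm _)).
  by rewrite /M (big_rem x) //= lerDl sumr_ge0.
have [x + xmin] := seq_argmin (fun x => line x t) B0.
rewrite mem_filter => /andP[/asboolP Fx xA].
exists x => //; split => // s' /maxB[y /xmin xy]; exact: le_trans.
Qed.

Lemma min_level_inj t s s' : min_level t s -> min_level t s' -> s = s'.
Proof. by move=> [Fs mins] [Fs' mins']; apply/le_anti; rewrite mins ?mins'. Qed.

(** The sum of the absolute slopes bounds each slope, so a line at height at most [s] over [t] has
    height at most [s + C * |t - t'|] over [t'], and [F] passes to that larger sublevel set. *)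
Lemma min_level_lipschitz : exists2 C, 0 <= C & forall t t' s s',
  min_level t s -> min_level t' s' -> `|s - s'| <= C * `|t - t'|.
Proof.
pose C := \sum_(x <- A) `|c x|.
exists C => [|t t' s s']; first exact: sumr_ge0.
have step v v' r r' : min_level v r -> min_level v' r' ->
    r' <= r + C * `|v - v'|.
  move=> [Fr _] [_]; apply; apply: F_incr Fr => x xA /= xr.
  have : line x v' = line x v + c x * (v' - v) by rewrite /line; ring.
  rewrite /sub /= => ->; apply: lerD => //; apply: (le_trans (ler_norm _)).
  rewrite normrM distrC ler_wpM2r //.
  by rewrite /C (big_rem x) //= lerDl sumr_ge0.
move=> m m'; rewrite ler_distl lerBlDr (step _ _ _ _ m m') /=.
by rewrite distrC step.
Qed.

Let crossing t : Prop := exists x y,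
  [/\ x \in A, y \in A, c x <> c y & line x t = line y t].

(* Only the order of the values [line x t] matters, and it is constant as long
   as no two lines cross. *)
Lemma min_level_stable a b t t' x : x \in A ->
    (forall r, a < r < b -> ~ crossing r) -> a < t < b -> a < t' < b ->
  min_level t (line x t) -> min_level t' (line x t').
Proof.
move=> xA nocross tab t'ab.
have order v v' y z : a < v < b -> a < v' < b -> y \in A -> z \in A ->
    line y v <= line z v -> line y v' <= line z v'.
  move=> vab v'ab yA zA yz; rewrite leNgt; apply/negP => zy.
  (* If the order of [y] and [z] changes, the difference of the lines goes from [- D] at [v] to [D']
     at [v']. It vanishes at the fraction [l] of the way, which is a forbidden crossing. *)
  pose D := line z v - line y v; pose D' := line y v' - line z v'.
  have D0 : 0 <= D by rewrite subr_ge0.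
  have D'0 : 0 < D' by rewrite subr_gt0.
  have S1 : 0 < D + D' by rewrite ltr_wpDl.
  have S0 : D + D' != 0 by rewrite gt_eqF.
  pose l := D / (D + D').
  have l01 : 0 <= l < 1.
    apply/andP; split; first by rewrite divr_ge0 // addr_ge0 // ltW.
    by rewrite ltr_pdivrMr // mul1r ltrDl.
  pose r := v + l * (v' - v).
  have rab : a < r < b by rewrite /r; nra.
  apply: (nocross _ rab); exists y, z; split=> //.
    by move=> cyz; move: yz zy; rewrite /line cyz; lra.
  apply/eqP; rewrite -subr_eq0; apply/eqP.
  transitivity (- D + l * (D + D')); first by rewrite /D /D' /line /r; ring.
  by rewrite /l divfK // /D; ring.
move=> [Fx minx]; split.
  by apply: F_incr Fx => y yA /=; exact: order.
move=> s' Fs'; have [y yA [Fy miny]] := min_level_line t'.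
apply: le_trans (miny _ Fs').
apply: (order _ _ _ _ tab t'ab xA yA); apply: minx.
by apply: F_incr Fy => z zA /=; exact: order.
Qed.

Lemma crossing_partition a b : a < b ->
  exists2 s, itv_partition a b s & forall k r, (k < size s)%N ->
    nth b (a :: s) k < r < nth b (a :: s) k.+1 -> ~ crossing r.
Proof.
move=> ab.
pose X := [seq (d p.2 - d p.1) / (c p.1 - c p.2) | p <- allpairs pair A A].
pose S := sort <=%O (undup [seq r <- X | a < r < b]).
have memS r : a < r < b -> crossing r -> r \in S.
  move=> rab [x [y [xA yA cxy xyr]]].
  rewrite mem_sort mem_undup mem_filter rab /=; apply/mapP.
  exists (x, y); first by apply/allpairsP; exists (x, y).
  have cxy0 : c x - c y != 0 by rewrite subr_eq0; apply/eqP.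
  apply: (mulIf cxy0) => /=; rewrite divfK //.
  have -> : d x = line y r - c x * r by rewrite -xyr /line; ring.
  by rewrite /line; ring.
have Sab r : r \in S -> a < r < b.
  by rewrite mem_sort mem_undup mem_filter => /andP[].
have ltS : path <%R a (rcons S b).
  rewrite rcons_path; apply/andP; split.
    rewrite path_sortedE; last exact: lt_trans.
    rewrite sort_lt_sorted undup_uniq andbT.
    by apply/allP => r /Sab /andP[].
  have : last a S \in a :: S by exact: mem_last.
  by rewrite inE => /orP[/eqP -> //|/Sab /andP[]].
exists (rcons S b); first by split=> //; rewrite last_rcons.
move=> k r kS /andP[kr rk] xr.
have mono i j : (i <= j)%N -> (j <= size (rcons S b))%N ->
    nth b (a :: rcons S b) i <= nth b (a :: rcons S b) j.
  move=> ij js; apply: (@sorted_leq_nth _ <=%R le_trans lexx) => //.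
  - by rewrite /=; apply: sub_path ltS => ? ?; exact: ltW.
  - by rewrite inE ltnS (leq_trans ij).
have lastb : nth b (a :: rcons S b) (size (rcons S b)) = b.
  by rewrite size_rcons /= nth_rcons ltnn eqxx.
have rab : a < r < b.
  rewrite (le_lt_trans (@mono 0%N k isT (ltnW kS)) kr) /=.
  by apply: (lt_le_trans rk); rewrite -[leRHS]lastb mono.
have /(nthP b)[j jS jr] := memS _ rab xr.
have {}jr : nth b (a :: rcons S b) j.+1 = r by rewrite /= nth_rcons jS.
(* The leading [a] shifts the index of [r] to [j.+1]. This index is at most [k] or at least [k.+1],
   so [r] cannot lie strictly between the entries at [k] and [k.+1]. *)
have [jk|kj] := leqP j.+1 k.
  by have := mono _ _ jk (ltnW kS); rewrite jr leNgt kr.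
have := @mono k.+1 j.+1 kj; rewrite size_rcons ltnS => /(_ (ltnW jS)).
by rewrite jr leNgt rk.
Qed.

(** Stability handles the open interval between consecutive cut points. The endpoints, where lines
    may cross, follow by Lipschitz continuity. *)
Lemma min_level_piecewise a b (u : R -> R) : a < b ->
    (forall t, min_level t (u t)) ->
  exists2 s, itv_partition a b s & forall k, (k < size s)%N ->
    exists2 x, x \in A &
      {in `[nth b (a :: s) k, nth b (a :: s) k.+1], forall t, u t = line x t}.
Proof.
move=> ab umin; have [s sab nocross] := crossing_partition ab.
exists s => // k ks.
have : nth b (a :: s) k < nth b (a :: s) k.+1.
  by case: sab => /(pathP b) /(_ k ks).
move: (nocross k).
move: (nth b (a :: s) k) (nth b (a :: s) k.+1) => v w {}nocross vw.
pose m := (v + w) / 2.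
have mvw : v < m < w by rewrite /m; lra.
have [x xA xm] := min_level_line m.
exists x => // t.
have inside r : v < r < w -> u r = line x r.
  move=> rvw; apply: min_level_inj (umin r) _.
  exact: (min_level_stable xA (nocross^~ ks)) mvw rvw xm.
rewrite in_itv /= => tvw.
have [C C0 lipu] := min_level_lipschitz.
apply/eqP; rewrite -subr_eq0 -normr_le0; apply/ler_addgt0Pl => e e0.
rewrite addr0.
(* [C + |c x|] is a Lipschitz constant for [u - line x]; adding 1 makes [K] positive. Moving from
   [t] towards the midpoint by the fraction [l] gives an interior point [r] within [e / K] of
   [t]. *)
pose K := C + `|c x| + 1.
have K0 : 0 < K by rewrite /K; have := normr_ge0 (c x); lra.
pose l := Num.min 1 (e / (K * (w - v))).
have wv0 : 0 < w - v by lra.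
have l01 : 0 < l <= 1.
  by rewrite /l lt_min ltr01 divr_gt0 ?mulr_gt0 //= ge_min lexx.
pose r := t + l * (m - t).
have rvw : v < r < w by rewrite /r; nra.
have -> : u t - line x t = (u t - u r) + c x * (r - t).
  by rewrite (inside _ rvw) /line; ring.
apply: (le_trans (ler_normD _ _)); rewrite normrM.
have tr : `|r - t| <= e / K.
  have -> : r - t = l * (m - t) by rewrite /r; ring.
  rewrite normrM ger0_norm; last by lra.
  have : `|m - t| <= w - v by rewrite ler_norml /m; lra.
  move=> mt; apply: (@le_trans _ _ (e / (K * (w - v)) * (w - v))).
    apply: ler_pM => //; first by lra.
    by rewrite /l ge_min lexx orbT.
  by rewrite invfM mulrA divfK // gt_eqF.
apply: (@le_trans _ _ ((C + `|c x|) * `|r - t|)).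
  rewrite mulrDl lerD2r distrC (distrC r).
  by rewrite (distrC t) lipu.
apply: (@le_trans _ _ ((C + `|c x|) * (e / K))).
  by rewrite ler_wpM2l ?addr_ge0.
by rewrite mulrA ler_pdivrMr // mulrC ler_pM2l // /K; lra.
Qed.

End MinimalLevel.

(** * One-sided derivatives of piecewise affine functions *)

Lemma itv_partition_right d (T : orderType d) (a b t : T) (s : seq T) :
  itv_partition a b s -> (a <= t < b)%O ->
  exists2 k, (k < size s)%N & (nth b (a :: s) k <= t < nth b (a :: s) k.+1)%O.
Proof.
elim: s a => [|x s IH] a sab /andP[at_ tb].
  by move: tb; rewrite -(itv_partition_nil sab) ltNge at_.
have [tx|xt] := ltP t x; first by exists 0%N; rewrite //= at_.
have [|k ks kt] := IH x (itv_partition_cons sab); first by rewrite xt.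
by exists k.+1.
Qed.

(** At a breakpoint this selects the piece that ends there, while [itv_partition_right] selects the
    piece that begins there. *)
Lemma itv_partition_left d (T : orderType d) (a b t : T) (s : seq T) :
  itv_partition a b s -> (a < t <= b)%O ->
  exists2 k, (k < size s)%N & (nth b (a :: s) k < t <= nth b (a :: s) k.+1)%O.
Proof.
elim: s a => [|x s IH] a sab /andP[at_ tb].
  by move: at_; rewrite (itv_partition_nil sab) ltNge tb.
have [tx|xt] := leP t x; first by exists 0%N; rewrite //= at_.
have [|k ks kt] := IH x (itv_partition_cons sab); first by rewrite xt.
by exists k.+1.
Qed.

Section OneSidedDerivatives.
Variables (R : realType) (f : R -> R) (t : R).

Lemma right_derivative_affine c d e : t < e ->
  {in `[t, e], forall x, f x = c * x + d} -> right_derivative f t c.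
Proof.
move=> te fE; apply: cvg_near_cst; near=> h.
have h0 : 0 < h by near: h; exact: nbhs_right_gt.
have he : h < e - t by near: h; apply: nbhs_right_lt; rewrite subr_gt0.
rewrite !fE ?in_itv /= ?lexx ?(ltW te) //; last by lra.
by field; rewrite gt_eqF.
Unshelve. all: by end_near. Qed.

Lemma left_derivative_affine c d e : e < t ->
  {in `[e, t], forall x, f x = c * x + d} -> left_derivative f t c.
Proof.
move=> te fE; apply: cvg_near_cst; near=> h.
have h0 : h < 0 by near: h; exact: nbhs_left_lt.
have he : e - t < h by near: h; apply: nbhs_left_gt; rewrite subr_lt0.
rewrite !fE ?in_itv /= ?lexx ?(ltW te) //; last by lra.
by field; rewrite lt_eqF.
Unshelve. all: by end_near. Qed.

Lemma singularP r l : right_derivative f t r -> left_derivative f t l ->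
  singular f t <-> r <> l.
Proof.
move=> fr fl.
have quotE : (fun h : R => h^-1 *: ((f \o shift t) (h *: (1 : R)) - f t)) =
    (fun h => h^-1 * (f (t + h) - f t)).
  by apply/funext => h; rewrite /= /GRing.scale /= mulr1 [h + t]addrC.
rewrite /singular /derivable quotE; split=> [nfl rl|rl fv].
  rewrite rl in fr; apply: nfl; apply: (cvgP l).
  exact: (@cvg_at_right_left_dnbhs _ R^o _ _ _ fr fl).
apply: rl; transitivity (lim ((fun h => h^-1 * (f (t + h) - f t)) @ 0^')).
  exact: cvg_unique fr (cvg_dnbhs_at_right fv).
exact: cvg_unique (cvg_dnbhs_at_left fv) fl.
Qed.

Lemma derive1_one_sided r : right_derivative f t r -> left_derivative f t r ->
  derive1 f t = r.
Proof.
move=> fr fl; rewrite /derive1; apply: cvg_lim => //.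
under eq_fun => h do rewrite [h + t]addrC.
exact: (@cvg_at_right_left_dnbhs _ R^o _ _ _ fr fl).
Qed.

End OneSidedDerivatives.

Section PiecewiseSelection.
Variables (R : realType) (T : eqType) (A : seq T) (c d : T -> R).
Variables (f : R -> R) (a b : R) (s : seq R).
Hypothesis sab : itv_partition a b s.
Hypothesis fE : forall k, (k < size s)%N -> exists2 x, x \in A &
  {in `[nth b (a :: s) k, nth b (a :: s) k.+1], forall t, f t = c x * t + d x}.

(** The affine formulas hold on closed pieces, so both the piece to the right of [t] and the piece
    to its left compute [f t]; hence the two lines meet over [t]. *)
Lemma one_sided_lines t : a < t < b -> exists x y,
  [/\ x \in A, y \in A, c x * t + d x = c y * t + d y,
      right_derivative f t (c x) & left_derivative f t (c y)].
Proof.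
move=> /andP[at_ tb].
have [|k ks /andP[kt tk]] := itv_partition_right sab (t := t).
  by rewrite (ltW at_).
have [|l ls /andP[lt tl]] := itv_partition_left sab (t := t).
  by rewrite at_ ltW.
have [x xA fx] := fE ks; have [y yA fy] := fE ls.
exists x, y; split=> //.
- by rewrite -(fx t) ?fy // in_itv /= ?kt ?tl ltW.
- apply: (right_derivative_affine tk (d := d x)) => r.
  rewrite in_itv /= => /andP[tr rk]; apply: fx.
  by rewrite in_itv /= rk (le_trans kt).
- apply: (left_derivative_affine lt (d := d y)) => r.
  rewrite in_itv /= => /andP[lr rt]; apply: fy.
  by rewrite in_itv /= lr (le_trans rt).
Qed.

End PiecewiseSelection.

Lemma lipschitz_continuous (R : realType) (f : R -> R) (C : R) :
  0 <= C -> (forall x y, `|f x - f y| <= C * `|x - y|) -> continuous f.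
Proof.
move=> C0 lipf x.
have C1 : 0 < C + 1 by lra.
apply/cvgrPdist_le => e e0; near=> y.
apply: (le_trans (lipf _ _)).
apply: (@le_trans _ _ ((C + 1) * `|x - y|)).
  by rewrite ler_wpM2r // lerDl.
rewrite mulrC -ler_pdivlMr //.
by near: y; apply: cvgr_dist_le; [exact: cvg_id|exact: divr_gt0].
Unshelve. all: by end_near. Qed.

(** * Subspaces and homogeneous components *)

Section Subspaces.
Variable V : lmodType Laurent.
Implicit Types S X Y : set V.

Lemma Fspan_subspace X : is_subspace (Fspan X).
Proof.
split=> [M [[M0 _] _] //|x y Xx Xy M XM].
by case: (XM) => -[_ MB] _; apply: MB; [exact: Xx|exact: Xy].
Qed.

Lemma Fspan_gen X : X `<=` Fspan X.
Proof. exact: sub_gen_smallest. Qed.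

Lemma Fspan_min X S : is_subspace S -> X `<=` S -> Fspan X `<=` S.
Proof. exact: smallest_sub. Qed.

Lemma Fspan_mono X Y : X `<=` Y -> Fspan X `<=` Fspan Y.
Proof.
move=> XY; apply: Fspan_min; first exact: Fspan_subspace.
by move=> x /XY; exact: Fspan_gen.
Qed.

End Subspaces.

Section HomogeneousComponents.
Variable C : gcomplex.
Hypothesis hC : is_gcomplex C.

(* Asking for all large enough index sequences makes this set closed under
   subtraction without merging sequences. *)
Definition off_degree (g : int) : set C :=
  [set x | exists (s : seq int) (y : int -> C),
    [/\ forall h, gr h (y h), y g = 0 &
        forall s', uniq s' -> {subset s <= s'} -> x = \sum_(h <- s') y h]].

Lemma off_degree_subspace g : is_subspace (off_degree g).
Proof.
split=> [|x y [s [u [ug u0 xE]]] [r [v [vg v0 yE]]]].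
  exists [::], (fun=> 0); split=> // [h|s' _ _]; last by rewrite big1_eq.
  by case: (gr_subspace hC h).
exists (s ++ r), (fun h => u h - v h); split=> [h||s' us' srs'].
- by case: (gr_subspace hC h) => _; apply.
- by rewrite u0 v0 subrr.
- rewrite sumrB -xE -?yE // => h hs; apply: srs'; rewrite mem_cat hs ?orbT //.
Qed.

Lemma gr_off_degree g h x : h <> g -> gr h x -> off_degree g x.
Proof.
move=> hg hx; exists [:: h], (fun k => if k == h then x else 0).
split=> [k||s us hs].
- by case: eqP => [->//|_]; case: (gr_subspace hC k).
- by case: eqP => // gh; case: hg.
- rewrite (bigD1_seq h) //=; last by apply: hs; exact: mem_head.
  by rewrite eqxx big1 ?addr0 // => k /negbTE ->.
Qed.

(** Putting [- x] in degree [g] of a decomposition of [x] that avoids [g] gives a vanishing sum of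
    homogeneous elements, and the sum of the degrees is direct. *)
Lemma off_degree_eq0 g x : off_degree g x -> gr g x -> x = 0.
Proof.
move=> [s [y [yg y0 xE]]] gx.
pose r : seq int := undup (g :: s).
pose v := fun h => if h == g then - x else y h.
have g_in : g \in r by rewrite mem_undup mem_head.
have vg h : gr h (v h).
  rewrite /v; case: eqP => [->|_] //.
  by rewrite -sub0r; case: (gr_subspace hC g) => g0 gB; exact: gB.
have xr : x = \sum_(h <- r) y h.
  apply: xE; first exact: undup_uniq.
  by move=> h hs; rewrite mem_undup inE hs orbT.
have v0 : \sum_(h <- r) v h = 0.
  rewrite (bigD1_seq g) ?undup_uniq //= {1}/v eqxx xr (bigD1_seq g) ?undup_uniq //=.
  rewrite y0 add0r -[RHS](addNr (\sum_(h <- r | h != g) y h)); congr (_ + _).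
  by apply: eq_bigr => h /negbTE hg; rewrite /v hg.
have := gr_direct hC (undup_uniq (g :: s)) vg v0 g_in.
by rewrite /v eqxx => /eqP; rewrite oppr_eq0 => /eqP.
Qed.

(** Serves as the target of [Fspan_min]: a claim on degree [g] components over a span then needs
    checking on generators only. *)
Lemma with_component_subspace S g : is_subspace S -> is_subspace
  [set x | exists x0, [/\ S x0, gr g x0 & off_degree g (x - x0)]].
Proof.
move=> [S0 SB]; have [g0 gB] := gr_subspace hC g.
have [off0 offB] := off_degree_subspace g.
split=> [|u v [u0 [Su gu ou]] [v0 [Sv gv ov]]].
  by exists 0; rewrite subr0.
exists (u0 - v0); split; [exact: SB|exact: gB|].
have -> : u - v - (u0 - v0) = (u - u0) - (v - v0).
  by rewrite !opprB [LHS]addrACA [RHS]addrACA [- v - u0]addrC.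
exact: offB.
Qed.

Lemma homogeneous_component S g x : graded_subspace S -> S x ->
  exists x0, [/\ S x0, gr g x0 & off_degree g (x - x0)].
Proof.
move=> [Ssub Sgr] /Sgr; apply: (Fspan_min (with_component_subspace g Ssub)).
have [g0 _] := gr_subspace hC g; have [off0 _] := off_degree_subspace g.
move=> u [Su [h _ hu]]; have [hg|hg] := eqVneq h g.
  by exists u; split; rewrite ?subrr // -hg.
exists 0; rewrite subr0; split=> //; first by case: Ssub.
by apply: gr_off_degree hu; apply/eqP.
Qed.

Lemma homogeneous_component_inj g x u v : gr g u -> gr g v ->
  off_degree g (x - u) -> off_degree g (x - v) -> u = v.
Proof.
move=> gu gv ou ov; apply/eqP; rewrite -subr_eq0; apply/eqP.
apply: (@off_degree_eq0 g); last by case: (gr_subspace hC g) => _; apply.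
have [_ offB] := off_degree_subspace g.
by have := offB _ _ ov ou; rewrite opprB addrCA [x - v]addrC addrK.
Qed.

End HomogeneousComponents.

(** * Filtered generators of a knot complex *)

Lemma has_level_min (C : gcomplex) (Fil : int -> set C) x m n :
  is_filtration Fil -> has_level Fil x m -> Fil n x -> m <= n.
Proof.
move=> FF [_ nx] nFx; rewrite leNgt; apply/negP => nm; apply: nx.
by apply: (fil_incr FF) nFx; lia.
Qed.

Lemma Upow_neq0 k : Upow k != 0.
Proof.
apply/eqP => /(congr1 val); rewrite raddf0 => /eqP.
by apply/negP; rewrite expfz_neq0 ?fracU_neq0.
Qed.

Lemma UpowD k l : Upow (k + l) = Upow k * Upow l.
Proof. by apply: val_inj; rewrite rmorphM /= expfzDr ?fracU_neq0. Qed.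

Lemma Upow0 : Upow 0 = 1.
Proof. by apply: val_inj; rewrite rmorph1. Qed.

Section KnotComplex.
Variable K : knot_complex.
Let hK := CF_complex K.

(** Otherwise 0 would have two coordinate families over the free basis: the zero family and the one
    with entry [Upow k] at [a]. *)
Lemma generator_neq0 k a : Upow k *: @xgen K a <> 0.
Proof.
move=> ka0; have [l [_ luniq]] := CF_free (0 : K).
have l0 : l = [ffun=> 0].
  by apply: luniq; rewrite big1 // => i _; rewrite ffunE scale0r.
have : l = [ffun i => if i == a then Upow k else 0].
  apply: luniq; rewrite (bigD1 a) //= ffunE eqxx ka0 add0r big1 // => i.
  by move=> /negbTE ia; rewrite ffunE ia scale0r.
rewrite l0 => /ffunP /(_ a); rewrite !ffunE eqxx => /esym /eqP.
exact/negP/Upow_neq0.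
Qed.

Lemma gr_Upow (n : nat) g (x : K) : gr g x -> gr (g - 2 * n%:Z) (Upow n *: x).
Proof.
elim: n g x => [|n IH] g x gx; first by rewrite mulr0 subr0 Upow0 scale1r.
rewrite -(addn1 n) PoszD UpowD -scalerA (_ : g - _ = g - 2 - 2 * n%:Z); last by lia.
exact/IH/(gr_U hK).
Qed.

(** [U] lowers the grading by 2, so with [k] and [l] distinct a nonzero element would be homogeneous
    in two degrees. Thus each [xgen a] has at most one translate in a given grading, whence
    finiteness. *)
Lemma generator_degree_inj g k l a :
  gr g (Upow k *: @xgen K a) -> gr g (Upow l *: xgen (k := K) a) -> k = l.
Proof.
wlog lk : k l / l < k => [hw|] gk gl.
  by have [/hw/(_ gl gk)|/hw/(_ gk gl)|//] := ltgtP k l.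
have [n kE] : exists n : nat, k = n%:Z + l by exists `|k - l|%N; lia.
case: (@generator_neq0 k a); apply: (off_degree_eq0 hK) gk.
apply: (@gr_off_degree _ hK g (g - 2 * n%:Z)); first by lia.
by rewrite kE UpowD -scalerA; exact: gr_Upow.
Qed.

Lemma gr0_generators : exists A : seq K,
  forall x, x \in A <-> filtered_generator x /\ gr 0 x.
Proof.
(* The translate of [xgen a] in grading 0. When there is none, the default exponent 0 yields an
   element outside grading 0, which the filter below discards. *)
pose e (a : 'I_(ngen K)) : K :=
  Upow (xget 0 [set k | gr 0 (Upow k *: xgen a)]) *: xgen a.
exists [seq e a | a <- enum 'I_(ngen K) & `[< gr 0 (e a) >]] => x; split.
  move=> /mapP[a + ->]; rewrite mem_filter => /andP[/asboolP ga _].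
  by split=> //; exists (xget 0 [set k | gr 0 (Upow k *: xgen a)], a).
move=> [[[k a] _ <-]] /= gx.
have ga : gr 0 (e a) by rewrite /e; case: xgetP => // /(_ k).
apply/mapP; exists a; last by rewrite (generator_degree_inj gx ga).
by rewrite mem_filter mem_enum andbT; exact/asboolP.
Qed.

(** Only the zero vector lacks a level, so the default 0 never occurs for a generator. *)
Definition gen_level (x : K) : int * int :=
  (xget 0 (has_level (@Alg K) x), xget 0 (has_level (@Alex K) x)).

Lemma gen_levelP (x : K) : x <> 0 ->
  has_level (@Alg K) x (gen_level x).1 /\ has_level (@Alex K) x (gen_level x).2.
Proof.
move=> x0; split; apply: xgetPex.
  exact: (fil_level (Alg_filtration K)).
exact: (fil_level (Alex_filtration K)).
Qed.

Lemma gr0_level_gen x :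
  filtered_generator x -> gr 0 x -> gr0_level K (gen_level x).
Proof.
move=> gx x0; exists x.
have [] // := @gen_levelP x.
by case: gx => [[k a] _ <-] /=; exact: generator_neq0.
Qed.

(** The basis elements of a bifiltered graded piece lie in that piece, so they obey the same level
    bounds as the element they express. *)
Lemma bifiltered_span g m n : gr g `&` @Alex K m `&` @Alg K n `<=`
  Fspan (@filtered_generator K `&` (gr g `&` @Alex K m `&` @Alg K n)).
Proof.
have [B Bgen [_ BE]] := @CF_basis K g m n.
rewrite -{1}BE; apply: Fspan_mono => x Bx; split; first exact: Bgen.
by rewrite -BE; exact: Fspan_gen.
Qed.

(** The image of 1 under the homotopy equivalence is a cycle. Were it a boundary, mapping it back
    would give 0, as the differential of [Laurent_complex] is zero; but the homotopy term vanishes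
    too, so mapping back gives 1. *)
Lemma H0_neq0 : exists z : K, [/\ gr 0 z, bd K z = 0 & forall w, z <> bd K w].
Proof.
have [f [g [_ [h [[_ _ fbd] [g0 _ gbd] _ [_ _ fg]]]]]] := CF_Laurent K.
exists (g (1 : Laurent^o)); split.
- rewrite -(addr0 0); apply: g0; apply: Fspan_gen.
  by exists 0; rewrite ?Upow0.
- by rewrite -gbd /= linear0.
- move=> w gw; have := fg (1 : Laurent^o).
  rewrite gw fbd /= linear0 addr0 sub0r => /eqP.
  by rewrite oppr_eq0 oner_eq0.
Qed.

End KnotComplex.

(** * Upsilon as a least sublevel value *)

Section UpsilonLevels.
Variables (R : realType) (K : knot_complex) (A : seq K).
Hypothesis memA : forall x, x \in A <-> @filtered_generator K x /\ gr 0 x.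
Let hK := CF_complex K.

(* The level of a generator of bifiltration level (i, j) under F_t is
   t / 2 * j + (1 - t / 2) * i = slope * t + offset. *)
Let slope (x : K) : R := ((gen_level x).2 - (gen_level x).1)%:~R / 2.
Let offset (x : K) : R := (gen_level x).1%:~R.

(** Surjectivity as a property of a set of generators alone, without [t] and [s]; the span of [A]
    already lies in grading 0. *)
Definition H0_surjective_span (X : set K) : Prop :=
  forall z : K, gr 0 z -> bd K z = 0 ->
    exists z' w : K, [/\ bd K z' = 0, Fspan ([set` A] `&` X) z', gr 1 w &
      z = z' + bd K w].

Lemma generator_of_mem x : x \in A -> x <> 0.
Proof. by move=> /memA[[[k a] _ <-] _]; exact: generator_neq0. Qed.

Lemma levelE (t : R) x : t / 2 * (gen_level x).2%:~R +
  (1 - t / 2) * (gen_level x).1%:~R = slope x * t + offset x.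
Proof. by rewrite /slope /offset intrB; field. Qed.

(** The summands in [filt] need not be homogeneous, but their degree 0 components keep both level
    bounds and expand in generators obeying them. For [t] in [[0, 2]] both weights are nonnegative,
    so these generators have F_t level at most [s]. *)
Lemma filt_gr0 (t s : R) x : 0 <= t <= 2 ->
  gr 0 x /\ filt t s x <->
  Fspan ([set` A] `&` [set x | slope x * t + offset x <= s]) x.
Proof.
move=> t02; set D := Fspan _.
have Dsub : is_subspace D by exact: Fspan_subspace.
split=> [[x0 xts]|]; last first.
  move=> Dx; split.
    apply: (Fspan_min (gr_subspace hK 0)) Dx => y [/memA[]//].
  apply: Fspan_mono Dx => y [/= yA ys].
  have [lAlg lAlex] := gen_levelP (generator_of_mem yA).
  by exists (gen_level y).2, (gen_level y).1; rewrite levelE.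
suff: exists y, [/\ D y, gr 0 y & off_degree 0 (x - y)].
  move=> [y [Dy y0 xy]]; suff -> : x = y by [].
  apply: (homogeneous_component_inj hK x0 y0 _ xy).
  by rewrite subrr; case: (off_degree_subspace hK 0).
apply: (Fspan_min (with_component_subspace hK 0 Dsub)) xts.
move=> y [m [n [[ym _] [yn _] mns]]].
have [z [zm z0 yz]] :=
  homogeneous_component hK 0 (fil_graded (Alex_filtration K) m) ym.
have [z' [zn z0' yz']] :=
  homogeneous_component hK 0 (fil_graded (Alg_filtration K) n) yn.
(* The components found inside the Alexander and the algebraic filtration coincide by uniqueness, so
   one element satisfies both bounds. *)
move: zn; rewrite -(homogeneous_component_inj hK z0 z0' yz yz') => zn.
exists z; split=> //.
apply: Fspan_mono (bifiltered_span (conj (conj z0 zm) zn)).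
move=> e [egen [[e0 em] en]].
have eA : e \in A by apply/memA.
split=> //=; apply: le_trans mns; rewrite -levelE.
have [lAlg lAlex] := gen_levelP (generator_of_mem eA).
have jm := has_level_min (Alex_filtration K) lAlex em.
have i_n := has_level_min (Alg_filtration K) lAlg en.
by apply: lerD; apply: ler_wpM2l; rewrite ?ler_int //; lra.
Qed.

Lemma H0_surjectiveE (t s : R) : 0 <= t <= 2 ->
  H0_surjective K t s <->
  H0_surjective_span [set x | slope x * t + offset x <= s].
Proof.
move=> t02; split=> surj z z0 dz; have [z' [w]] := surj z z0 dz.
  move=> [z0' dz' ts w1 zE]; exists z', w; split=> //.
  by apply/(filt_gr0 _ _ t02).
move=> [dz' /(filt_gr0 _ _ t02)[z0' ts] w1 zE].
by exists z', w.
Qed.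

Lemma H0_surjective_span_incr (X Y : set K) :
  (forall x, x \in A -> X x -> Y x) ->
  H0_surjective_span X -> H0_surjective_span Y.
Proof.
move=> XY surj z z0 dz; have [z' [w [dz' Xz' w1 zE]]] := surj z z0 dz.
exists z', w; split=> //; apply: Fspan_mono Xz' => x [/= xA Xx].
by split=> //; exact: XY.
Qed.

Lemma H0_surjective_span_full : H0_surjective_span setT.
Proof.
move=> z z0 dz; exists z, 0; split=> //; last by rewrite linear0 addr0.
  rewrite setIT; have [->|/eqP zn0] := eqVneq z 0.
    by case: (Fspan_subspace [set` A]).
  have [m [zm _]] := fil_level (Alex_filtration K) zn0.
  have [n [zn _]] := fil_level (Alg_filtration K) zn0.
  apply: Fspan_mono (bifiltered_span (conj (conj z0 zm) zn)).
  by move=> e [egen [[e0 _] _]]; apply/memA.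
by case: (gr_subspace hK 1).
Qed.

Lemma H0_surjective_span_empty : ~ H0_surjective_span set0.
Proof.
move=> surj; have [z [z0 dz nbd]] := H0_neq0 K.
have [z' [w [_ + _ zE]]] := surj z z0 dz.
rewrite setI0 => z'0; apply: (nbd w); rewrite zE.
suff -> : z' = 0 by rewrite add0r.
apply: (@Fspan_min _ set0 [set 0]) z'0 => //.
by split=> // x y /= -> ->; rewrite subrr.
Qed.

(** [nu] is a choice from the set of minima, so its value is determined once that set is seen to
    have at most one element. *)
Lemma nu_min_level (t s : R) : 0 <= t <= 2 ->
  min_level slope offset H0_surjective_span t s -> nu K t = s.
Proof.
move=> t02 [surj smin]; apply: xget_subset1.
  split; first by apply/(H0_surjectiveE _ t02).
  by move=> s' /(H0_surjectiveE _ t02); exact: smin.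
move=> r r' [rs rmin] [rs' rmin'].
by apply/le_anti; rewrite rmin // rmin'.
Qed.

Lemma Upsilon_lines : {within `[0, 2], continuous (Upsilon K : R -> R)} /\
  exists2 s : seq R, itv_partition 0 2 s & forall k, (k < size s)%N ->
    exists2 x, x \in A & {in `[nth 2 (0 :: s) k, nth 2 (0 :: s) k.+1],
      forall t, Upsilon K t =
        ((gen_level x).1 - (gen_level x).2)%:~R * t - 2 * (gen_level x).1%:~R}.
Proof.
have incr := H0_surjective_span_incr.
have full := H0_surjective_span_full.
have empty := H0_surjective_span_empty.
(* [u] is defined on the whole line and agrees with [nu] on [[0, 2]], so a global Lipschitz bound on
   [u] yields continuity there. *)
have /choice[u uP] t : exists s, min_level slope offset H0_surjective_span t s.
  have [x _ xt] := min_level_line slope offset incr full empty t.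
  by exists (slope x * t + offset x).
have uE t : 0 <= t <= 2 -> Upsilon K t = - 2 * u t.
  by move=> t02; rewrite /Upsilon (nu_min_level t02 (uP t)).
split.
  apply: (@subspace_eq_continuous _ _ _ (fun t => - 2 * u t)).
    by move=> t; rewrite inE /= in_itv /= => t02; exact/esym/uE.
  apply: continuous_subspaceT.
  have [C C0 lip] := min_level_lipschitz slope offset incr.
  apply: (@lipschitz_continuous _ _ (2 * C)) => [|x y]; first lra.
  rewrite -mulrBr normrM normrN (gtr0_norm (ltr0n R 2)) -mulrA ler_pM2l //.
  exact: lip.
have [|s sP lines] := @min_level_piecewise _ _ _ slope offset _ incr full empty
  0 2 u _ uP; first lra.
exists s => // k ks; have [x xA xE] := lines k ks.
exists x => // t tk; rewrite uE.
  by rewrite xE // /slope /offset !intrB; field.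
move: tk; rewrite in_itv /= => /andP[kt tk].
apply/andP; split; [apply: le_trans kt|apply: (le_trans tk)].
  by apply: itv_partition_nth_ge sP; exact: ltnW.
exact: (itv_partition_nth_le (m := k.+1) ks sP).
Qed.

End UpsilonLevels.

(** * Slopes and singularities of Upsilon in terms of lattice points *)

Theorem theorem8p1 (R : realType) (K : knot_complex) :
  [/\ {within `[0, 2], continuous (Upsilon K : R -> R)} /\
      piecewise_linear 0 2 (Upsilon K : R -> R),
      forall t : R, 0 < t < 2 -> ~ singular (Upsilon K) t ->
        exists2 p : int * int, gr0_level K p &
          `|derive1 (Upsilon K) t| = `|p.1 - p.2|%:~R,
      forall t : R, 0 < t < 2 -> singular (Upsilon K) t ->
        exists p q : int * int, collinear_gr0_pair K t p q &
      forall t : R, 0 < t < 2 -> singular (Upsilon K) t ->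
        exists2 delta : R, derivative_jump (Upsilon K) t delta &
          exists2 pq : (int * int) * (int * int),
            collinear_gr0_pair K t pq.1 pq.2 &
            `|delta| = 2 / t * `|pq.1.1 - pq.2.1|%:~R].
Proof.
have [A memA] := gr0_generators K.
have [cont [s sP lines]] := Upsilon_lines R memA.
have sides t := one_sided_lines sP lines (t := t).
have levelA x : x \in A -> gr0_level K (gen_level x).
  by move=> /memA[]; exact: gr0_level_gen.
(* Shared by the last two claims: [p] comes from the line followed to the right of [t], and [q] from
   the one followed to the left. *)
have jump (t : R) : 0 < t < 2 -> singular (Upsilon K) t ->
    exists p q : int * int, [/\ collinear_gr0_pair K t p q,
      right_derivative (Upsilon K) t (p.1 - p.2)%:~R,
      left_derivative (Upsilon K) t (q.1 - q.2)%:~R &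
      (p.1 - p.2)%:~R - (q.1 - q.2)%:~R = 2 / t * (p.1 - q.1)%:~R :> R].
  move=> t02 sing; have t0 : t != 0 by case/andP: t02 => ? _; rewrite gt_eqF.
  have [x [y [xA yA xy fr fl]]] := sides t t02.
  exists (gen_level x), (gen_level y).
  move: (levelA x xA) (levelA y yA) fr fl xy.
  case: (gen_level x) (gen_level y) => i j [i' j'] /= px py fr fl xy.
  (* Equality of the two lines over [t], divided by [t], puts both points on one line of slope
     [1 - 2 / t]; the parenthesis is its intercept. *)
  have jE : j%:~R = (1 - 2 / t) * i%:~R + (j'%:~R - (1 - 2 / t) * i'%:~R) :> R.
    apply: (mulIf t0).
    have -> : j%:~R * t = i%:~R * t - 2 * i%:~R -
        ((i - j)%:~R * t - 2 * i%:~R) :> R by rewrite intrB; ring.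
    by rewrite xy intrB; field.
  split=> //; last by rewrite !intrB jE; field.
  (* Equal lattice points would give equal one-sided derivatives, against singularity. *)
  split=> // [[ii jj]|].
    by move/(singularP fr fl): sing; apply; rewrite ii jj.
  exists (j'%:~R - (1 - 2 / t) * i'%:~R); split; rewrite /on_line //=.
  by rewrite addrC subrK.
split.
- split=> //; exists s => // k ks; have [x _ xE] := lines k ks.
  by exists ((gen_level x).1 - (gen_level x).2)%:~R, (- 2 * (gen_level x).1%:~R)
    => t /xE ->; rewrite mulNr.
- move=> t t02 nsing; have [x [y [xA yA _ fr fl]]] := sides t t02.
  exists (gen_level x); first exact: levelA.
  have xy : ((gen_level x).1 - (gen_level x).2)%:~R =
      ((gen_level y).1 - (gen_level y).2)%:~R :> R.
    by apply: contrapT => xy; apply/nsing/(singularP fr fl).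
  by rewrite (derive1_one_sided fr) ?intr_norm // xy.
- by move=> t t02 /(jump t t02)[p [q [pq _ _ _]]]; exists p, q.
- move=> t t02 /(jump t t02)[p [q [pq fr fl pqE]]].
  exists ((p.1 - p.2)%:~R - (q.1 - q.2)%:~R).
    by exists (p.1 - p.2)%:~R, (q.1 - q.2)%:~R.
  exists (p, q) => //=; rewrite pqE normrM gtr0_norm ?intr_norm //.
  by rewrite divr_gt0 //; case/andP: t02.
Qed.
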